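(* For any string $S$, $|\mathcal{PS}_S| \leq 2|S| - |\mathcal{M}_S|$.
   Context: For a string $S$ of length $n$ and $1 \le i \le j \le n$, $S[i..j]$ is the substring from position $i$ to position $j$, and $\#\mathit{occ}_S(w)$ is the number of positions $i$ with $S[i..i+|w|-1]=w$. A non-empty substring $w$ is unique if $\#\mathit{occ}_S(w)=1$ and repeating if $\#\mathit{occ}_S(w)\ge 2$; an interval $[i,j]$ is called unique/repeating according to $S[i..j]$. An interval $[i,j]$ is a minimal unique substring (MUS) of $S$ if $S[i..j]$ is unique and every proper substring $S[i'..j']$ with $i\le i'$, $j'\le j$, $j'-i'<j-i$ is repeating; $\mathcal{M}_S$ is the set of all MUS intervals of $S$. For intervals, $[s,t]\subset[i,j]$ means $i\le s$ and $t\le j$. For an interval $[s,t]$, an interval $[i,j]$ is a shortest unique substring (SUS) for $[s,t]$ if (1) $S[i..j]$ is unique, (2) $[s,t]\subset[i,j]$, and (3) $S[i'..j']$ is repeating for every $[i',j']$ with $[s,t]\subset[i',j']$ and $j'-i'<j-i$. $\mathsf{SUS}_S(p)$ denotes the set of SUSs for $[p,p]$, and $\mathcal{PS}_S=\bigcup_{p=1}^{n}\mathsf{SUS}_S(p)$ is the set of all point SUSs of $S$. *)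

(* Defs.v *)
From mathcomp Require Import all_boot all_order all_algebra.

Set Implicit Arguments.
Unset Strict Implicit.
Unset Printing Implicit Defensive.

Section PointSUS.

Variable T : eqType.

(* S[i..j], with 1-based positions; meaningful when 1 <= i. *)
Definition substr (S : seq T) (i j : nat) : seq T :=
  take (j.+1 - i) (drop i.-1 S).

Definition occ (S w : seq T) : nat :=
  count (fun i => ((i + size w).-1 <= size S) &&
                  (substr S i (i + size w).-1 == w))
        (iota 1 (size S)).

Definition is_unique (S w : seq T) : bool := (w != [::]) && (occ S w == 1).

Definition is_repeating (S w : seq T) : bool := (w != [::]) && (2 <= occ S w).

(* Pairs (i, j) with 0 <= i, j <= |S|; the actual intervals [i, j] of S are
   those satisfying is_interval below. *)
Definition str_interval (S : seq T) : predArgType :=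
  ('I_(size S).+1 * 'I_(size S).+1)%type.

Definition is_interval (S : seq T) (I : str_interval S) : bool :=
  (1 <= I.1) && (I.1 <= I.2).

Definition uniqueI (S : seq T) (I : str_interval S) : bool :=
  is_unique S (substr S I.1 I.2).

Definition repeatingI (S : seq T) (I : str_interval S) : bool :=
  is_repeating S (substr S I.1 I.2).

(* Non-strict inclusion of intervals. *)
Definition subI (S : seq T) (I J : str_interval S) : bool :=
  (J.1 <= I.1) && (I.2 <= J.2).

(* Compares lengths minus one; no truncation occurs on actual intervals. *)
Definition shorterI (S : seq T) (I J : str_interval S) : bool :=
  I.2 - I.1 < J.2 - J.1.

Definition MUS (S : seq T) : {set str_interval S} :=
  [set I : str_interval S |
    [&& is_interval I, uniqueI I &
      [forall J : str_interval S,
         [&& is_interval J, subI J I & shorterI J I] ==> repeatingI J]]].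

Definition SUS (S : seq T) (K : str_interval S) : {set str_interval S} :=
  [set I : str_interval S |
    [&& is_interval I, uniqueI I, subI K I &
      [forall J : str_interval S,
         [&& is_interval J, subI K J & shorterI J I] ==> repeatingI J]]].

Definition point_SUS (S : seq T) : {set str_interval S} :=
  \bigcup_(p : 'I_(size S).+1 | 1 <= p) SUS (p, p).

End PointSUS.

(* Main.v *)
Require Import Defs.
From mathcomp Require Import all_boot all_order all_algebra.
From mathcomp Require Import zify.

(** Let [E1] (resp. [E2]) be the set of unique intervals that are shortest among
    the unique intervals with the same start (resp. the same end).  Each has at
    most [n] elements, one per position.  A MUS lies in both.  A point SUS
    [[i, j]] for [p] lies in one of them: otherwise there are unique intervals
    [[i, j']] and [[i', j]] strictly inside it, both of which must miss [p], so
    that [i <= j' < p < i']; but then [[p, j]] is unique, contains [p] and is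
    shorter than [[i, j]].  Hence
    [|PS| + |M| <= |E1 :|: E2| + |E1 :&: E2| = |E1| + |E2| <= 2n]. *)

Lemma sub_in_count (U : eqType) (a b : pred U) (s : seq U) :
  {in s, subpred a b} -> count a s <= count b s.
Proof.
move=> sub_ab; rewrite -(@eq_in_count _ (predI a (mem s))) => [|x /= ->].
  by apply: sub_count => x /= /andP[ax sx]; apply: sub_ab.
by rewrite andbT.
Qed.

Section PointSUSBound.

Variable T : eqType.
Implicit Types (S u w : seq T).

(** Translation by [size u] sends occurrences of [u ++ w] injectively to occurrences of [w]. *)
Lemma leq_occ_suffix S u w : w != [::] -> occ S (u ++ w) <= occ S w.
Proof.
move=> wn0; set Q := fun i => ((i + size w).-1 <= size S) &&
                  (substr S i (i + size w).-1 == w).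
have wgt0 : 0 < size w by rewrite lt0n size_eq0.
have PQ i : i \in iota 1 (size S) ->
    ((i + size (u ++ w)).-1 <= size S) &&
      (substr S i (i + size (u ++ w)).-1 == u ++ w) -> Q (size u + i).
  rewrite mem_iota => /andP[igt0 _] /andP[le_n /eqP eq_uw].
  rewrite size_cat in le_n eq_uw; apply/andP; split; first by lia.
  move: eq_uw; rewrite /substr.
  have -> : (i + (size u + size w)).-1.+1 - i = size u + size w by lia.
  have -> : (size u + i + size w).-1.+1 - (size u + i) = size w by lia.
  have -> : (size u + i).-1 = size u + i.-1 by lia.
  rewrite -drop_drop [take (size w) _]take_drop addnC => ->.
  by rewrite drop_size_cat.
have sz_u : iota (1 + size u) (size S) = map (addn (size u)) (iota 1 (size S)).
  by rewrite -iotaDl addnC.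
(* Extending the range makes room for the shifted positions and adds nothing to the count: a
   non-empty [w] cannot start beyond position [size S]. *)
have -> : occ S w = count Q (iota 1 (size S + size u)).
  rewrite iotaD count_cat; set c := count Q (iota _ (size u)).
  suff -> : c = 0 by rewrite addn0.
  apply/eqP; rewrite eqn0Ngt -has_count; apply/hasPn => i.
  by rewrite mem_iota => /andP[? _]; apply/nandP; left; lia.
rewrite addnC iotaD count_cat sz_u count_map.
apply: leq_trans (leq_addl _ _).
exact: sub_in_count PQ.
Qed.

Lemma is_repeating_suffix S (i k j : nat) : 0 < i -> i <= k -> k <= j ->
  j <= size S -> is_repeating S (substr S i j) -> is_repeating S (substr S k j).
Proof.
move=> i0 ik kj jn /andP[_ occ2].
have wn0 : substr S k j != [::].
  by rewrite -size_eq0 /substr size_take size_drop; case: ifP; lia.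
have def_w : substr S i j = take (k - i) (drop i.-1 S) ++ substr S k j.
  rewrite /substr; have -> : j.+1 - i = (k - i) + (j.+1 - k) by lia.
  by rewrite takeD drop_drop; have -> : k - i + i.-1 = k.-1 by lia.
by apply/andP; split=> //; apply: leq_trans occ2 _; rewrite def_w leq_occ_suffix.
Qed.

Lemma repeatingI_not_uniqueI S (I : str_interval S) :
  repeatingI I -> ~~ uniqueI I.
Proof.
by rewrite /repeatingI /uniqueI => /andP[_ H]; apply/nandP; right; lia.
Qed.

(** The sets [E1] and [E2] are the cases where [f] is the left or the right endpoint. *)
Definition shortest_unique_in_class {S} (f : str_interval S -> 'I_(size S).+1) :
    {set str_interval S} :=
  [set I | [&& is_interval I, uniqueI I &
    [forall J : str_interval S,
      [&& is_interval J, f J == f I & shorterI J I] ==> ~~ uniqueI J]]].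

(** Two shortest members of one class have equal length, hence coincide; so [f] is injective on the
    set, and it takes only the [size S] positive values. *)
Lemma card_shortest_unique_in_class S (f : str_interval S -> 'I_(size S).+1) :
    (forall I, is_interval I -> 0 < f I) ->
    (forall I J, is_interval I -> is_interval J -> f I = f J ->
       I.2 - I.1 = J.2 - J.1 -> I = J) ->
  #|shortest_unique_in_class f| <= size S.
Proof.
move=> f_gt0 f_inj; set E := shortest_unique_in_class f.
have injE : {in E &, injective f}.
  move=> I J; rewrite !inE => /and3P[intI uI /forallP minI].
  move=> /and3P[intJ uJ /forallP minJ] eqf; apply: f_inj => //.
  have := minI J; have := minJ I.
  by rewrite intI intJ eqf eqxx uI uJ /= !implybF /shorterI; lia.
rewrite -(card_in_imset injE).
have card_pos : #|[set~ (ord0 : 'I_(size S).+1)]| = size S.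
  by rewrite cardsC1 card_ord.
rewrite -[leqRHS]card_pos; apply/subset_leq_card/subsetP => _ /imsetP[I + ->].
by rewrite !inE => /and3P[/f_gt0 + _ _]; rewrite -val_eqE /=; lia.
Qed.

Lemma card_shortest_unique_from S :
  #|shortest_unique_in_class (fun I : str_interval S => I.1)| <= size S.
Proof.
apply: card_shortest_unique_in_class => [I /andP[]//|[i j] [i' j']].
rewrite /is_interval /= => /andP[? ?] /andP[? ?] eqi; subst i' => ?.
by congr pair; apply: val_inj => /=; lia.
Qed.

Lemma card_shortest_unique_to S :
  #|shortest_unique_in_class (fun I : str_interval S => I.2)| <= size S.
Proof.
apply: card_shortest_unique_in_class => [I /andP[] /leq_trans h /h//|[i j] [i' j']].
rewrite /is_interval /= => /andP[? ?] /andP[? ?] eqj; subst j' => ?.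
by congr pair; apply: val_inj => /=; lia.
Qed.

(** A shorter interval sharing an endpoint with a MUS lies inside it, hence is repeating. *)
Lemma MUS_shortest_unique S :
  MUS S \subset shortest_unique_in_class (fun I : str_interval S => I.1)
            :&: shortest_unique_in_class (fun I : str_interval S => I.2).
Proof.
apply/subsetP => I; rewrite !inE => /and3P[intI uI /forallP minI].
rewrite intI uI /=; apply/andP; split; apply/forallP => J;
  apply/implyP => /and3P[intJ /eqP eqf shJ];
  apply: repeatingI_not_uniqueI; have /implyP := minI J; apply;
  move: intI intJ shJ (congr1 val eqf); rewrite /is_interval /subI /shorterI /=;
  lia.
Qed.

Lemma point_SUS_shortest_unique S :
  point_SUS S \subset
    shortest_unique_in_class (fun I : str_interval S => I.1)
      :|: shortest_unique_in_class (fun I : str_interval S => I.2).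
Proof.
apply/subsetP => I /bigcupP[p p_gt0]; rewrite inE.
case/and4P=> intI uI subI_p /forallP minI.
rewrite !inE intI uI /= -[_ || _]negbK negb_or; apply/negP => /andP[].
move=> /forallPn[J] + /forallPn[K].
rewrite 2!negb_imply 2!negbK => /andP[/and3P[intJ /eqP eqJ shJ] uJ].
move=> /andP[/and3P[intK /eqP eqK shK] uK].
have missp (L : str_interval S) :
    is_interval L -> shorterI L I -> uniqueI L -> ~~ subI (p, p) L.
  move=> intL shL uL; apply/negP => pL.
  have /implyP := minI L; rewrite intL pL shL => /(_ isT).
  by move/repeatingI_not_uniqueI; rewrite uL.
have := missp _ intJ shJ uJ; have := missp _ intK shK uK.
move: subI_p intI intJ intK shJ shK (congr1 val eqJ) (congr1 val eqK).
rewrite /subI /is_interval /shorterI /= => ? ? ? ? ? ? ? ? ? ?.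
(* Since [J] starts with [I] and ends before [p], the interval [(p, I.2)] is strictly shorter than
   [I], hence repeating by minimality of [I]. *)
have /implyP := minI (p, I.2); rewrite /is_interval /subI /shorterI /= => rep.
have : repeatingI K.
  (* [K] ends with [I] and starts after [p], so it is a suffix of the repeating [(p, I.2)]. *)
  rewrite /repeatingI eqK; apply: (@is_repeating_suffix _ p); try lia.
    by rewrite -ltnS.
  by apply: rep; lia.
by move/repeatingI_not_uniqueI; rewrite uK.
Qed.

Lemma card_point_SUS_MUS S : #|point_SUS S| + #|MUS S| <= 2 * size S.
Proof.
apply: leq_trans (leq_add (subset_leq_card (point_SUS_shortest_unique S))
                          (subset_leq_card (MUS_shortest_unique S))) _.
rewrite cardsUI mul2n -addnn.
exact: leq_add (card_shortest_unique_from S) (card_shortest_unique_to S).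
Qed.

End PointSUSBound.

Theorem theorem1 (T : eqType) (S : seq T) :
  (#|point_SUS S|%:Z <= 2%:Z * (size S)%:Z - #|MUS S|%:Z)%R.
Proof. by have := card_point_SUS_MUS T S; lia. Qed.
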